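(* Assume that $g$ is Lipschitz-continuous with a constant $\ell_g>0$ and that the stabilization parameter satisfies $\kappa\ge2\ell_g$. Let $\tau>0$. Consider the two-stage scheme ($s=2$) $$U^{n,i+1}=U^{n,1}+\sum_{j=1}^{i}\hat a_{i+1,j}(-\tau L_\kappa)\big[\tau g_\kappa(U^{n,j})-\tau L_\kappa U^{n,1}\big],\quad 1\le i\le 2,\qquad U^{n,1}=u_h^{n-1},\ u_h^n=U^{n,3},\ n\ge1,$$ with either of the following sets of coefficients: (TIF2-Heun) $\hat a_{21}(z)=\frac1{1-z}$, $\ \hat a_{31}(z)=\frac1{2-z(1+e^{-z})}$, $\ \hat a_{32}(z)=\frac1{2e^z-z(1+e^z)}$; (NIF2-Heun) $\hat a_{21}(z)=\frac{e^z-1}{z}$, $\ \hat a_{31}(z)=\frac12e^z$, $\ \hat a_{32}(z)=\frac{e^z-1}{z}-\frac12e^z$. Then both the TIF2-Heun and the NIF2-Heun schemes preserve the original energy dissipation law at all stages (in the sense defined in the context).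
   Context: Setting: $L_h$ is a symmetric positive definite real $M\times M$ matrix (a spatial discretization of a stiff linear operator). $G$ is a non-negative differentiable (Lyapunov) function and $g(v)=-\frac{\delta}{\delta v}G(v)$, i.e. $g=-G'$; both $G$ and $g$ act componentwise on vectors in $\mathbb{R}^M$. The inner product is $\langle u,v\rangle:=v^Tu$. The original energy is $E[u]:=\frac12\langle u,L_hu\rangle+\langle G(u),1\rangle$, where $1$ is the all-ones vector; the problem $u_h'+L_hu_h=g(u_h)$ is the gradient flow $\frac{du_h}{dt}=-\frac{\delta E}{\delta u_h}$, with $\frac{dE}{dt}=-\langle\frac{du_h}{dt},\frac{du_h}{dt}\rangle\le0$. For $\kappa\ge0$ put $L_\kappa:=L_h+\kappa I$, $g_\kappa(u):=\kappa u+g(u)$, so the gradient flow is equivalently $u_h'=-L_\kappa u_h+g_\kappa(u_h)$. Functions $f(-\tau L_\kappa)$ are matrix functions of the symmetric matrix $-\tau L_\kappa$ (spectrum in $(-\infty,0)$). Differentiation matrix: for an $s$-stage scheme of the displayed form, let $\widehat A(z):=[\hat a_{i+1,j}(z)]_{i,j=1}^s$ (lower triangular, with zero entries for $j>i$), $E_s:=(1_{i\ge j})_{s\times s}$ the lower triangular all-ones matrix, $I$ the identity, and $$D(z):=\widehat A(z)^{-1}E_s+zE_s-\frac z2I .$$ $D_j(z):=D[1:j,1:j]$ is its $j$-th leading principal submatrix, and $D_j(-\tau L_\kappa)$ is the $j\times j$ block matrix obtained by replacing each scalar entry $d_{k\ell}(z)$ with the matrix $d_{k\ell}(-\tau L_\kappa)$.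 Put $\delta_\tau U^{n,\ell+1}:=U^{n,\ell+1}-U^{n,\ell}$ and $\delta_\tau\vec U_{n,j+1}:=(\delta_\tau U^{n,2},\dots,\delta_\tau U^{n,j+1})^T$. The scheme ''preserves the original energy dissipation law at all stages'' means: for all $n\ge1$ and $1\le j\le s$, $$E[U^{n,j+1}]-E[U^{n,1}]\le-\frac1\tau\big\langle\delta_\tau\vec U_{n,j+1},\,D_j(-\tau L_\kappa)\,\delta_\tau\vec U_{n,j+1}\big\rangle\le 0,$$ where the inner product of block vectors is the sum of the inner products of the blocks; in particular $E[U^{n,j+1}]\le E[U^{n,1}]$. *)

(* Defs.v *)
From HB Require Import structures.
From mathcomp Require Import all_boot all_order all_algebra.
From mathcomp Require Import all_classical all_reals all_analysis.

Set Implicit Arguments.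
Unset Strict Implicit.
Unset Printing Implicit Defensive.
Import Order.TTheory GRing.Theory Num.Theory.
Import numFieldNormedType.Exports.
Local Open Scope classical_set_scope.
Local Open Scope ring_scope.

Section MatrixFunctions.
Variable R : realType.

Definition inner (m : nat) (u v : 'cV[R]_m) : R := (v^T *m u) 0 0.

Definition sym_posdef (m : nat) (L : 'M[R]_m) : Prop :=
  L^T = L /\ forall v : 'cV[R]_m, v != 0 -> 0 < inner v (L *m v).

(* B is f(A) computed in some orthonormal eigenbasis of A. *)
Definition is_matfun (m : nat) (f : R -> R) (A B : 'M[R]_m) : Prop :=
  exists (P : 'M[R]_m) (d : 'rV[R]_m),
    [/\ P^T *m P = 1%:M,
        A = P^T *m diag_mx d *m P
      & B = P^T *m diag_mx (map_mx f d) *m P].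

(* Meaningful for symmetric A only; 0 when A is not orthogonally
   diagonalizable. *)
Definition matfun (m : nat) (f : R -> R) (A : 'M[R]_m) : 'M[R]_m :=
  xget 0 [set B | is_matfun f A B].

Lemma is_matfun_uniq (m : nat) (f : R -> R) (A B C : 'M[R]_m) :
  is_matfun f A B -> is_matfun f A C -> B = C.
Proof.
move=> [P [d [PP AP ->]]] [Q [e [QQ AQ ->]]].
have PP' : P *m P^T = 1%:M by exact: mulmx1C.
have QQ' : Q *m Q^T = 1%:M by exact: mulmx1C.
have WE (X Y : 'M[R]_m) : P^T *m X *m P = Q^T *m Y *m Q <->
    (Q *m P^T) *m X = Y *m (Q *m P^T).
  split=> XY.
    rewrite -[LHS]mulmx1 -PP' -[Y]mul1mx -QQ' -!mulmxA.
    by have := congr1 (fun Z => Q *m Z *m P^T) XY; rewrite /= -!mulmxA.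
  rewrite -[LHS]mul1mx -QQ -[RHS]mulmx1 -PP -!mulmxA.
  by have := congr1 (fun Z => Q^T *m Z *m P) XY; rewrite /= -!mulmxA.
apply/WE; have /WE := etrans (esym AP) AQ.
rewrite !mul_mx_diag !mul_diag_mx => /matrixP W.
apply/matrixP => i j; move: (W i j); rewrite !mxE.
move: (\sum_k _) => w; have [->|w0] := eqVneq w 0; first by rewrite !mul0r !mulr0.
by rewrite mulrC => /(mulIf w0) ->; rewrite mulrC.
Qed.

Lemma matfunE (m : nat) (f : R -> R) (A B : 'M[R]_m) :
  is_matfun f A B -> matfun f A = B.
Proof.
move=> AB; apply: is_matfun_uniq (AB).
by rewrite /matfun; case: xgetP => [C _ //|/(_ B)]; case.
Qed.

End MatrixFunctions.

Section Schemes.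
Variable R : realType.

(* a i j is the coefficient \hat a_{i,j}; indices are 1-based, as are the stage
   numbers below, and only 1 <= j < i <= s + 1 are meaningful. *)
Implicit Type a : nat -> nat -> R -> R.

Definition Amat (s : nat) a (z : R) : 'M[R]_s :=
  \matrix_(i < s, j < s) (if (j <= i)%N then a i.+2 j.+1 z else 0).

Definition Emat (s : nat) : 'M[R]_s :=
  \matrix_(i < s, j < s) (j <= i)%N%:R.

Definition Dmat (s : nat) a (z : R) : 'M[R]_s :=
  invmx (Amat s a z) *m Emat s + z *: Emat s - (z / 2) *: 1%:M.

Definition leading (s j : nat) (hj : (j <= s)%N) (A : 'M[R]_s) : 'M[R]_j :=
  mxsub (widen_ord hj) (widen_ord hj) A.

Definition Dblock (s j : nat) (hj : (j <= s)%N) a (m : nat) (X : 'M[R]_m) :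
    'M[R]_(\sum_(k < j) m, \sum_(l < j) m) :=
  \mxblock_(k < j, l < j) matfun (fun z => leading hj (Dmat s a z) k l) X.

Definition block_inner (j m : nat) (x y : 'cV[R]_(\sum_(k < j) m)) : R :=
  \sum_(k < j) inner (submxcol x k) (submxcol y k).

Definition Lkappa (m : nat) (L : 'M[R]_m) (kappa : R) : 'M[R]_m :=
  L + kappa%:M.

Definition gkappa (m : nat) (g : R -> R) (kappa : R) (u : 'cV[R]_m) :
    'cV[R]_m :=
  kappa *: u + map_mx g u.

Definition energy (m : nat) (L : 'M[R]_m) (G : R -> R) (u : 'cV[R]_m) : R :=
  2^-1 * inner u (L *m u) + inner (map_mx G u) (const_mx 1).

(* u n is u_h^n and U n i is U^{n,i}, for n >= 1 and 1 <= i <= s + 1. *)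
Definition is_scheme (s : nat) a (m : nat) (L : 'M[R]_m) (g : R -> R)
    (kappa tau : R) (u : nat -> 'cV[R]_m) (U : nat -> nat -> 'cV[R]_m) : Prop :=
  forall n : nat, (1 <= n)%N ->
    [/\ U n 1%N = u n.-1,
        forall i : nat, (1 <= i <= s)%N ->
          U n i.+1 = U n 1%N +
            \sum_(1 <= j < i.+1)
              matfun (a i.+1 j) (- tau *: Lkappa L kappa) *m
                (tau *: gkappa g kappa (U n j)
                 - tau *: (Lkappa L kappa *m U n 1%N))
      & u n = U n s.+1].

(* k is 0-based here: the k-th block is U^{n,k+2} - U^{n,k+1}. *)
Definition increments (j m : nat) (V : nat -> 'cV[R]_m) :
    'cV[R]_(\sum_(k < j) m) :=
  \mxcol_(k < j) (V k.+2 - V k.+1).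

Definition preserves_energy_law (s : nat) a (m : nat) (L : 'M[R]_m)
    (G g : R -> R) (kappa tau : R) : Prop :=
  forall (u : nat -> 'cV[R]_m) (U : nat -> nat -> 'cV[R]_m),
    is_scheme s a L g kappa tau u U ->
    forall (n j : nat) (hj : (j <= s)%N), (1 <= n)%N -> (1 <= j)%N ->
      energy L G (U n j.+1) - energy L G (U n 1%N)
        <= - tau^-1 * block_inner (increments j (U n))
             (Dblock hj a (- tau *: Lkappa L kappa) *m increments j (U n))
        <= 0.

Definition TIF2_Heun : nat -> nat -> R -> R := fun i j z =>
  match i, j with
  | 2, 1 => 1 / (1 - z)
  | 3, 1 => 1 / (2 - z * (1 + expR (- z)))
  | 3, 2 => 1 / (2 * expR z - z * (1 + expR z))
  | _, _ => 0
  end.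

Definition NIF2_Heun : nat -> nat -> R -> R := fun i j z =>
  match i, j with
  | 2, 1 => (expR z - 1) / z
  | 3, 1 => 2^-1 * expR z
  | 3, 2 => (expR z - 1) / z - 2^-1 * expR z
  | _, _ => 0
  end.

End Schemes.
Arguments TIF2_Heun {R}.
Arguments NIF2_Heun {R}.

(* Main.v *)
(** If delta_i = U^{n,i+1} - U^{n,i}, then inverting the scheme gives
    (D(-tau L_kappa) delta)_i =
      tau g_kappa(U^{n,i}) - (tau/2) L_kappa (U^{n,i} + U^{n,i+1}),
    and the mean value theorem together with kappa / 2 >= lg bounds
    E[U^{n,i+1}] - E[U^{n,i}] by -(1/tau) <delta_i, (D delta)_i>.
    In an orthonormal eigenbasis of -tau L_kappa, whose eigenvalues are all
    negative, the quadratic form of D splits into the 2x2 forms of D(z), z < 0,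
    which are nonnegative by a discriminant computation. *)
Require Import Defs.
From HB Require Import structures.
From mathcomp Require Import all_boot all_order all_algebra.
From mathcomp Require Import all_classical all_reals all_analysis.
From mathcomp Require Import spectral complex ring lra.
Set Implicit Arguments.
Unset Strict Implicit.
Unset Printing Implicit Defensive.
Import Order.TTheory GRing.Theory Num.Theory.
Import numFieldNormedType.Exports.
Local Open Scope classical_set_scope.
Local Open Scope ring_scope.

(** * Bilinearity and positivity of the inner product *)

Section Inner.
Variable R : realType.

Lemma innerE (m : nat) (u v : 'cV[R]_m) : inner u v = \sum_i u i 0 * v i 0.
Proof. by rewrite /inner mxE; apply: eq_bigr => i _; rewrite mxE mulrC. Qed.

Lemma innerC (m : nat) (u v : 'cV[R]_m) : inner u v = inner v u.
Proof. by rewrite !innerE; apply: eq_bigr => i _; rewrite mulrC. Qed.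

Lemma innerBl (m : nat) (u v w : 'cV[R]_m) :
  inner (u - v) w = inner u w - inner v w.
Proof. by rewrite /inner mulmxBr mxE [X in _ + X]mxE. Qed.

Lemma innerBr (m : nat) (u v w : 'cV[R]_m) :
  inner w (u - v) = inner w u - inner w v.
Proof. by rewrite !(innerC w) innerBl. Qed.

Lemma innerDr (m : nat) (u v w : 'cV[R]_m) :
  inner w (u + v) = inner w u + inner w v.
Proof. by rewrite /inner linearD /= mulmxDl mxE. Qed.

Lemma innerZl (m : nat) (c : R) (u v : 'cV[R]_m) :
  inner (c *: u) v = c * inner u v.
Proof. by rewrite /inner -scalemxAr mxE. Qed.

Lemma innerZr (m : nat) (c : R) (u v : 'cV[R]_m) :
  inner v (c *: u) = c * inner v u.
Proof. by rewrite !(innerC v) innerZl. Qed.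

Lemma inner_gt0 (m : nat) (u : 'cV[R]_m) : u != 0 -> 0 < inner u u.
Proof.
move=> /cV0Pn [i ui0]; rewrite innerE (bigD1 i) //= ltr_pwDl //.
  by rewrite -expr2 exprn_even_gt0.
by apply: sumr_ge0 => j _; rewrite -expr2 sqr_ge0.
Qed.

End Inner.

(** * Spectral theorem for real symmetric matrices *)

Section RealSpectral.
Variable R : realType.

(* The complexification of A is Hermitian, hence has a real eigenvalue. *)
Lemma sym_eigenvalue (n : nat) (A : 'M[R]_n.+1) :
  A^T = A -> exists a, eigenvalue A a.
Proof.
move=> AT; pose Ac := map_mx (real_complex R) A.
have Aherm : Ac \is hermsymmx.
  apply: realsym_hermsym.
    by apply/is_hermitianmxP; rewrite expr0 scale1r map_mx_id // /Ac map_trmx AT.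
  by apply/mxOverP => i j; rewrite mxE complex_real.
have /mxOverP dreal := hermitian_spectral_diag_real Aherm.
have /hermitian_normalmx/orthomx_spectralP AE := Aherm.
have Punit := spectral_unit Ac.
have [a da] := complex_realP _ (dreal 0 0).
(* The characteristic polynomial of [Ac] is the image of that of [A] under the embedding, so their
   real roots agree. *)
exists a; rewrite eigenvalue_root_char -(fmorph_root (real_complex R)).
rewrite map_char_poly -/Ac -eigenvalue_root_char.
suff : eigenvalue Ac (spectral_diag Ac 0 0) by rewrite da.
apply/eigenvalueP; exists (row 0 (spectralmx Ac)).
  rewrite {2}AE -row_mul !mulmxA mulmxV // mul1mx.
  by rewrite mul_diag_mx; apply/rowP => j; rewrite !mxE.
(* A zero row would make the determinant of the invertible [spectralmx Ac] vanish. *)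
apply/eqP => r0; move: Punit.
rewrite unitmxE (expand_det_row _ 0) big1 ?unitr0 //.
by move=> j _; have /rowP/(_ j) := r0; rewrite !mxE => ->; rewrite mul0r.
Qed.

(** Reflecting in the hyperplane orthogonal to [v - e] swaps the unit vectors [e] and [v]; when they
    coincide the identity serves. *)
Lemma householder (n : nat) (e v : 'cV[R]_n) : inner e e = 1 -> inner v v = 1 ->
  exists H : 'M[R]_n, [/\ H^T = H, H *m H = 1%:M & H *m e = v].
Proof.
move=> ee vv; have [->|ve] := eqVneq e v.
  by exists 1%:M; rewrite trmx1 !mul1mx.
pose w := v - e.
have w0 : 0 < inner w w by rewrite inner_gt0 // subr_eq0 eq_sym.
have wTw : w^T *m w = (inner w w)%:M by rewrite [LHS]mx11_scalar.
(* Since [e] and [v] are unit vectors, [e] has component -1/2 along [w], so the reflection adds [w]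
   to [e]. *)
have we : w^T *m e = (- (inner w w / 2))%:M.
  rewrite [LHS]mx11_scalar; congr (_ %:M).
  by rewrite -/(inner e w) /w !innerBr !innerBl (innerC e v) ee vv; field.
exists (1%:M - (2 / inner w w) *: (w *m w^T)); split.
- by rewrite linearB /= linearZ /= trmx1 trmx_mul trmxK.
- rewrite mulmxBl !mulmxBr !mul1mx mulmx1 -scalemxAl -scalemxAr -mulmxA.
  rewrite (mulmxA w^T) wTw mul_scalar_mx -!scalemxAr !scalerA.
  rewrite -addrA -opprD addrA [X in _ - (X - _)](_ : _ =
      (2 / inner w w * 2 / inner w w * inner w w) *: (w *m w^T)); last first.
    by rewrite -scalerDl; congr (_ *: _); field; rewrite gt_eqF.
  by rewrite !mulrA subrr subr0.
- rewrite mulmxBl mul1mx -scalemxAl -mulmxA we mul_mx_scalar.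
  rewrite scalerA [X in _ - X *: _](_ : _ = -1); last by field; rewrite gt_eqF.
  by rewrite scaleN1r opprK addrC subrK.
Qed.

(* Induction on the size: a Householder reflection sending the first basis
   vector to a unit eigenvector splits off a 1x1 block. *)
Lemma sym_orthodiag (n : nat) (A : 'M[R]_n) : A^T = A ->
  exists (P : 'M[R]_n) (d : 'rV[R]_n),
    P^T *m P = 1%:M /\ A = P^T *m diag_mx d *m P.
Proof.
elim: n => [|n IHn] in A *.
  by move=> _; exists 1%:M, 0; split; apply/matrixP => -[].
move=> AT; have [a /eigenvalueP [u0 uA u0N]] := sym_eigenvalue AT.
pose u := u0^T; have uN : u != 0 by rewrite trmx_eq0.
have Au : A *m u = a *: u by rewrite -AT -trmx_mul uA linearZ.
have uu := inner_gt0 uN.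
pose v := (Num.sqrt (inner u u))^-1 *: u.
have vv : inner v v = 1.
  rewrite /v innerZl innerZr mulrA -invfM -expr2.
  by rewrite sqr_sqrtr ?ltW // mulVf // gt_eqF.
have Av : A *m v = a *: v by rewrite -scalemxAr Au scalerA mulrC -scalerA.
pose e : 'cV[R]_(1 + n) := col_mx 1%:M 0.
have ee : inner e e = 1.
  by rewrite /inner /e tr_col_mx mul_row_col trmx0 mulmx0 addr0 trmx1 mul1mx mxE.
have [H [HT HH He]] := householder (e := e) ee vv.
pose B : 'M[R]_(1 + n) := H *m A *m H.
have BT : B^T = B by rewrite /B !trmx_mul HT AT mulmxA.
have Be : B *m e = a *: e.
  by rewrite /B -!mulmxA He Av -scalemxAr -He mulmxA HH mul1mx.
pose A' := drsubmx B.
have A'T : A'^T = A' by rewrite /A' trmx_drsub BT.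
(* The eigenvector equation [Be] fixes the first column of [B]; symmetry then clears the first
   row. *)
have BE : B = block_mx a%:M 0 0 A'.
  have BC : col_mx (ulsubmx B) (dlsubmx B) = a *: e.
    by rewrite -Be -[in RHS](submxK B) mul_block_col !mulmx0 !addr0 !mulmx1.
  have [ul dl] : ulsubmx B = a%:M /\ dlsubmx B = 0.
    by apply/eq_col_mx; rewrite BC /e scale_col_mx scaler0 scalemx1.
  by rewrite -[LHS]submxK ul dl -[ursubmx B]trmxK trmx_ursub BT dl trmx0.
have [P' [d' [PP' AE]]] := IHn _ A'T.
pose Q : 'M[R]_(1 + n) := block_mx 1%:M 0 0 P'.
pose d : 'rV[R]_(1 + n) := row_mx a%:M d'.
have QQ : Q^T *m Q = 1%:M.
  rewrite /Q tr_block_mx mulmx_block !trmx0 trmx1 !mul0mx !mulmx0 !addr0 !add0r.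
  by rewrite mul1mx PP' -scalar_mx_block.
exists (Q *m H), d; split.
  by rewrite trmx_mul HT -mulmxA (mulmxA Q^T) QQ mul1mx.
have -> : A = H *m B *m H by rewrite /B !mulmxA HH mul1mx -mulmxA HH mulmx1.
have -> : B = Q^T *m diag_mx d *m Q.
  rewrite BE AE /d diag_mx_row /Q tr_block_mx !mulmx_block !trmx0 trmx1.
  rewrite !mul0mx !mulmx0 !addr0 !add0r !mul0mx ?mulmx0 mul1mx mulmx1.
  congr (block_mx _ 0 0 _); apply/matrixP => i j; rewrite !ord1 !mxE.
  by rewrite eqxx.
by rewrite trmx_mul HT !mulmxA.
Qed.

End RealSpectral.

(** * Matrix functions in eigenbasis coordinates *)

Section SpectralCalculus.
Variable R : realType.

Lemma sym_posdefDscalar (m : nat) (L : 'M[R]_m) (kappa : R) :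
  0 <= kappa -> sym_posdef L -> sym_posdef (Lkappa L kappa).
Proof.
move=> k0 [LT Lpos]; split=> [|v v0].
  by rewrite /Lkappa linearD /= LT tr_scalar_mx.
rewrite mulmxDl innerDr mul_scalar_mx innerZr.
by rewrite ltr_pwDl ?Lpos // mulr_ge0 // ltW // inner_gt0.
Qed.

Variables (m : nat) (X P : 'M[R]_m) (d : 'rV[R]_m).
Hypotheses (PP : P^T *m P = 1%:M) (XE : X = P^T *m diag_mx d *m P).

Lemma coord_inj (u v : 'cV[R]_m) :
  (forall i, (P *m u) i 0 = (P *m v) i 0) -> u = v.
Proof.
move=> uv; rewrite -[u]mul1mx -[v]mul1mx -PP -!mulmxA; congr (_ *m _).
by apply/colP.
Qed.

Lemma inner_coord (u v : 'cV[R]_m) :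
  inner u v = \sum_i (P *m u) i 0 * (P *m v) i 0.
Proof.
rewrite -innerE /inner; congr (_ 0 0).
by rewrite trmx_mul -!mulmxA (mulmxA P^T) PP mul1mx.
Qed.

(** The value of a matrix function does not depend on the eigenbasis, so [P] may serve; matrix
    identities then become scalar ones at each eigenvalue. *)
Lemma matfun_coord (f : R -> R) (v : 'cV[R]_m) i :
  (P *m (matfun f X *m v)) i 0 = f (d 0 i) * (P *m v) i 0.
Proof.
rewrite (@matfunE _ _ _ _ (P^T *m diag_mx (map_mx f d) *m P)); last first.
  by exists P, d.
by rewrite !mulmxA (mulmx1C PP) mul1mx -mulmxA mul_diag_mx !mxE.
Qed.

Lemma mulmx_coord (v : 'cV[R]_m) i :
  (P *m (X *m v)) i 0 = d 0 i * (P *m v) i 0.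
Proof. by rewrite XE !mulmxA (mulmx1C PP) mul1mx -mulmxA mul_diag_mx !mxE. Qed.

(** The quadratic form of [X] takes the value [d 0 i] at the [i]-th column of [P^T], a unit
    eigenvector. *)
Lemma spectrum_lt0 (i : 'I_m) : (forall v, v != 0 -> inner v (X *m v) < 0) ->
  d 0 i < 0.
Proof.
have Pv : P *m (P^T *m delta_mx i 0) = delta_mx i (0 : 'I_1).
  by rewrite mulmxA (mulmx1C PP) mul1mx.
move=> /(_ (P^T *m delta_mx i 0)) => Xneg.
have -> : d 0 i = inner (P^T *m delta_mx i 0) (X *m (P^T *m delta_mx i 0)).
  rewrite inner_coord (bigD1 i) //= mulmx_coord Pv !mxE !eqxx /= mulr1 mul1r.
  by rewrite big1 ?addr0 // => k /negPf ki; rewrite mxE ki mul0r.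
apply: Xneg; apply/eqP => v0; move: Pv; rewrite v0 mulmx0.
by move=> /matrixP/(_ i 0) /eqP; rewrite !mxE !eqxx eq_sym oner_eq0.
Qed.

End SpectralCalculus.

(** * Energy change from one stage to the next *)

Section EnergyIncrement.
Variable R : realType.

(** The mean value theorem gives [- g c * (y - x)] with [c] between [x] and [y]; replacing [g c] by
    [g x] costs at most [lg * (y - x) ^+ 2]. *)
Lemma lipschitz_gradient (G g : R -> R) (lg : R) :
  (forall x, derivable G x 1) -> (forall x, g x = - (G^`())%classic x) ->
  0 <= lg -> lg.-lipschitz g ->
  forall x y, G y - G x <= - g x * (y - x) + lg * (y - x) ^+ 2.
Proof.
move=> Gd gE lg0 glip.
have glip' x y : `|g x - g y| <= lg * `|x - y| by exact: (glip (x, y)).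
have mvt a b : a <= b ->
    exists2 c, c \in `[a, b]%R & G b - G a = - g c * (b - a).
  move=> ab; apply: (MVT_segment ab) => [x _|].
    rewrite gE opprK derive1E; exact/derivableP.
  apply: derivable_within_continuous => x _; exact: Gd.
move=> x y.
have [c cxy ->] : exists2 c, `|x - c| <= `|y - x| & G y - G x = - g c * (y - x).
  have [xy|/ltW yx] := leP x y.
    have [c + cE] := mvt _ _ xy; rewrite in_itv /= => /andP[xc cy].
    by exists c => //; rewrite distrC !ger0_norm ?subr_ge0 //; lra.
  have [c + cE] := mvt _ _ yx; rewrite in_itv /= => /andP[yc cx].
  exists c; last by move: cE; lra.
  rewrite distrC ler0_norm ?subr_le0 // opprB distrC ger0_norm ?subr_ge0 //.
  lra.
have : (g x - g c) * (y - x) <= lg * (y - x) ^+ 2.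
  apply: le_trans (ler_norm _) _; rewrite normrM -real_normK ?num_real // expr2.
  rewrite mulrA ler_wpM2r //; apply: le_trans (glip' _ _) _.
  by rewrite ler_wpM2l.
lra.
Qed.

(** By symmetry of [L], the right side is the exact change of the quadratic energy, minus
    [inner (v - u) (map_mx g u)], plus [kappa / 2 * inner (v - u) (v - u)]. The last term absorbs
    the error in [G] because [lg <= kappa / 2]. *)
Lemma energy_increment (m : nat) (L : 'M[R]_m) (G g : R -> R) (kappa tau lg : R)
    (u v : 'cV[R]_m) :
  L^T = L -> 0 < tau -> 2 * lg <= kappa ->
  (forall x y, G y - G x <= - g x * (y - x) + lg * (y - x) ^+ 2) ->
  energy L G v - energy L G u <=
    - tau^-1 * inner (v - u)
      (tau *: gkappa g kappa u - (tau / 2) *: (Lkappa L kappa *m (u + v))).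
Proof.
move=> LT tau0 hk Gub.
have Gsum : inner (map_mx G v) (const_mx 1) - inner (map_mx G u) (const_mx 1) <=
    - inner (v - u) (map_mx g u) + kappa / 2 * inner (v - u) (v - u).
  rewrite !innerE -!sumrN mulr_sumr -!big_split /= ler_sum // => i _.
  rewrite !mxE !mulr1; apply: le_trans (Gub _ _) _.
  by have := sqr_ge0 (v i 0 - u i 0); nra.
have Lsym : inner v (L *m u) = inner u (L *m v).
  by rewrite innerC /inner trmx_mul LT mulmxA.
rewrite /energy /gkappa /Lkappa; move: Gsum.
rewrite !mulmxDl !mulmxDr !mul_scalar_mx !(innerBl, innerBr, innerDr, innerZr).
rewrite Lsym (innerC v u) => Gsum.
rewrite [leRHS](_ : _ = 2^-1 * (inner v (L *m v) - inner u (L *m u)) +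
  (- (inner v (map_mx g u) - inner u (map_mx g u)) + kappa / 2 *
   (inner v v - inner u v - (inner u v - inner u u)))); last first.
  by field; rewrite gt_eqF.
lra.
Qed.

End EnergyIncrement.

(** * Reduction of the two-stage energy law to scalar conditions *)

Section TwoStage.
Variable R : realType.

(* The entries of D for s = 2, computed from
   A^-1 = [[1/a21, 0], [-a31/(a21 a32), 1/a32]]. *)
Definition Dmat2_entry (a : nat -> nat -> R -> R) (z : R) (i j : nat) : R :=
  match i, j with
  | 0, 0 => (a 2 1 z)^-1 + z / 2
  | 0, _ => 0
  | _, 0 => (a 2 1 z - a 3 1 z) / (a 2 1 z * a 3 2 z) + z
  | _, _ => (a 3 2 z)^-1 + z / 2
  end.

Lemma Dmat2E (a : nat -> nat -> R -> R) (z : R) (i j : 'I_2) :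
  a 2 1 z != 0 -> a 3 2 z != 0 -> Dmat 2 a z i j = Dmat2_entry a z i j.
Proof.
move=> a21 a32.
pose B : 'M[R]_2 := \matrix_(i < 2, j < 2)
  match nat_of_ord i, nat_of_ord j with
  | 0, 0 => (a 2 1 z)^-1
  | 0, _ => 0
  | _, 0 => - a 3 1 z / (a 2 1 z * a 3 2 z)
  | _, _ => (a 3 2 z)^-1
  end.
have AB : Amat 2 a z *m B = 1%:M.
  apply/matrixP => -[[|[|//]] ?] [[|[|//]] ?];
    rewrite !mxE !big_ord_recl big_ord0 !mxE /=; by field; rewrite ?a21 ?a32.
have AV : invmx (Amat 2 a z) = B.
  by rewrite -[RHS](mulKmx (mulmx1_unit AB).1 B) AB mulmx1.
rewrite /Dmat AV; case: i j => -[|[|//]] ? [[|[|//]] ?];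
  rewrite !mxE !big_ord_recl big_ord0 !mxE /=; by field; rewrite ?a21 ?a32.
Qed.

Lemma block_inner_increments (s j : nat) (hj : (j <= s)%N)
    (a : nat -> nat -> R -> R) (m : nat) (X : 'M[R]_m) (V : nat -> 'cV[R]_m) :
  block_inner (increments j V) (Dblock hj a X *m increments j V) =
  \sum_(k < j) inner (V k.+2 - V k.+1)
    (\sum_(l < j) matfun (fun z => leading hj (Dmat s a z) k l) X
                    *m (V l.+2 - V l.+1)).
Proof.
rewrite /block_inner /Dblock /increments mul_mxblock_mxrow.
by apply: eq_bigr => k _; rewrite !mxcolK.
Qed.

(** The coefficients enter only through two conditions at negative [z]: a nonzero diagonal of the
    coefficient matrix and a nonnegative quadratic form of D(z). *)
Lemma two_stage_energy_law (a : nat -> nat -> R -> R) (m : nat) (L : 'M[R]_m)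
    (G g : R -> R) (kappa tau lg : R) :
  sym_posdef L -> 0 < tau -> 0 <= lg -> 2 * lg <= kappa ->
  (forall x y, G y - G x <= - g x * (y - x) + lg * (y - x) ^+ 2) ->
  (forall z : R, z < 0 -> a 2 1 z != 0 /\ a 3 2 z != 0) ->
  (forall z x y : R, z < 0 -> 0 <= ((a 2 1 z)^-1 + z / 2) * x ^+ 2 +
    ((a 2 1 z - a 3 1 z) / (a 2 1 z * a 3 2 z) + z) * (x * y) +
    ((a 3 2 z)^-1 + z / 2) * y ^+ 2) ->
  preserves_energy_law 2 a L G g kappa tau.
Proof.
move=> Lpos tau0 lg0 hk Gub an0 Dpos u U sch n j hj n1 j1.
have [_ stage _] := sch n n1; move: (U n) stage => V stage {u U sch n n1}.
have k0 : 0 <= kappa by apply: le_trans hk; rewrite mulr_ge0.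
have [KT Kpos] := sym_posdefDscalar k0 Lpos.
set K := Lkappa L kappa in KT Kpos stage *; set X := - tau *: K in stage *.
have XT : X^T = X by rewrite linearZ /= KT.
have [P [d [PP XE]]] := sym_orthodiag XT.
have d0 i : d 0 i < 0.
  apply: (spectrum_lt0 PP XE) => v v0.
  by rewrite -scalemxAl innerZr mulNr oppr_lt0 mulr_gt0 // Kpos.
(* The expected row [k] of D applied to the increments; [k] is 0-based, hence the shifted stage
   numbers. *)
pose S k := tau *: gkappa g kappa (V k.+1)
  - (tau / 2) *: (K *m (V k.+1 + V k.+2)).
have N1 := stage 1%N isT; have N2 := stage 2%N isT.
rewrite big_nat1 in N1; rewrite big_nat_recr //= big_nat1 in N2.
have rowD (k : 'I_j) : \sum_(l < j)
    matfun (fun z => leading hj (Dmat 2 a z) k l) X *m (V l.+2 - V l.+1) = S k.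
  apply: (coord_inj PP) => i; have [a21 a32] := an0 _ (d0 i).
  rewrite mulmx_sumr summxE.
  under eq_bigr do rewrite (matfun_coord PP XE) mxE Dmat2E //.
  pose c (w : 'cV[R]_m) : R := (P *m w) i 0.
  have cD w1 w2 : c (w1 + w2) = c w1 + c w2 by rewrite /c mulmxDr mxE.
  have cB w1 w2 : c (w1 - w2) = c w1 - c w2.
    by rewrite /c mulmxBr mxE [X in _ + X]mxE.
  have cZ r w : c (r *: w) = r * c w by rewrite /c -scalemxAr mxE.
  have cK w : c (K *m w) = - (d 0 i * c w) / tau.
    rewrite -(mulmx_coord PP XE) -/(c _) -scalemxAl cZ; field.
    by rewrite gt_eqF.
  have cstage f w : c (matfun f X *m (tau *: w - tau *: (K *m V 1%N))) =
      f (d 0 i) * (tau * c w + d 0 i * c (V 1%N)).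
    rewrite [LHS](matfun_coord PP XE) -/(c _) cB !cZ cK; field.
    by rewrite gt_eqF.
  under eq_bigr do rewrite -/(c _) cB.
  have C1 := congr1 c N1; have C2 := congr1 c N2.
  rewrite cD cstage in C1; rewrite !cD !cstage in C2.
  have -> : (P *m S k) i 0 = tau * c (gkappa g kappa (V k.+1)) +
      d 0 i / 2 * (c (V k.+1) + c (V k.+2)).
    rewrite -/(c (S k)) /S cB !cZ cK cD; field; by rewrite gt_eqF.
  (* Substituting the stage values leaves rational identities in [d 0 i]. As D is lower triangular,
     truncating to [j = 1] keeps all of row 0. *)
  case: j k hj {j1} => [|[|[|//]]] [[|[|//]] hk2] // hj;
    rewrite !big_ord_recl big_ord0 /= ?C2 ?C1; field;
    rewrite ?a21 ?a32 ?gt_eqF //.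
rewrite block_inner_increments; under eq_bigr do rewrite rowD.
apply/andP; split.
  have -> : energy L G (V j.+1) - energy L G (V 1%N) =
      \sum_(k < j) (energy L G (V k.+2) - energy L G (V k.+1)).
    pose E k := energy L G (V k.+1).
    by rewrite -(big_mkord xpredT (fun k => E k.+1 - E k)) telescope_sumr.
  rewrite mulr_sumr ler_sum // => k _.
  exact: energy_increment Lpos.1 tau0 hk Gub.
rewrite mulNr oppr_le0 mulr_ge0 //; first by rewrite invr_ge0 ltW.
(* Going back from [S] to D and exchanging the sums gives one scalar quadratic form per
   eigenvalue. *)
under eq_bigr do rewrite -rowD (inner_coord PP).
rewrite exchange_big /=; apply: sumr_ge0 => i _.
have [a21 a32] := an0 _ (d0 i).
under eq_bigr => k _.
  rewrite mulmx_sumr summxE.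
  under eq_bigr do rewrite (matfun_coord PP XE) mxE Dmat2E //.
  over.
case: j hj j1 {rowD} => [|[|[|//]]] // hj _; rewrite !big_ord_recl !big_ord0 /=.
  (* For [j = 1] only the first increment occurs, so the form is taken at [y = 0]. *)
  have := Dpos (d 0 i) ((P *m (V 2%N - V 1%N)) i 0) 0 (d0 i).
  by congr (_ <= _); ring.
have := Dpos (d 0 i) ((P *m (V 2%N - V 1%N)) i 0)
  ((P *m (V 3%N - V 2%N)) i 0) (d0 i).
by congr (_ <= _); ring.
Qed.

End TwoStage.

(** * Sign conditions for the two sets of Heun coefficients *)

Section HeunCoefficients.
Variable R : realType.

(** Completing the square in [x]. *)
Lemma quad_form_ge0 (a b c x y : R) : 0 < a -> b ^+ 2 <= 4 * a * c ->
  0 <= a * x ^+ 2 + b * (x * y) + c * y ^+ 2.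
Proof.
move=> a0 disc.
have -> : a * x ^+ 2 + b * (x * y) + c * y ^+ 2 =
    ((2 * a * x + b * y) ^+ 2 + (4 * a * c - b ^+ 2) * y ^+ 2) / (4 * a).
  by field; rewrite gt_eqF.
rewrite divr_ge0 //; last by lra.
by rewrite addr_ge0 ?sqr_ge0 // mulr_ge0 ?sqr_ge0 // subr_ge0.
Qed.

Lemma TIF2_Heun_neq0 (z : R) : z < 0 ->
  TIF2_Heun 2 1 z != 0 /\ TIF2_Heun 3 2 z != 0.
Proof.
move=> z0; have e0 := expR_gt0 z; rewrite /TIF2_Heun !div1r !invr_eq0.
by split; rewrite gt_eqF //; nra.
Qed.

(* Here D = [[1 - z/2, 0], [e^z, 2 e^z - z/2 - z e^z]]. *)
Lemma TIF2_Heun_ge0 (z x y : R) (a := TIF2_Heun) : z < 0 ->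
  0 <= ((a 2 1 z)^-1 + z / 2) * x ^+ 2 +
    ((a 2 1 z - a 3 1 z) / (a 2 1 z * a 3 2 z) + z) * (x * y) +
    ((a 3 2 z)^-1 + z / 2) * y ^+ 2.
Proof.
move=> z0; have e0 := expR_gt0 z; have e1 : expR z < 1 by rewrite expR_lt1.
have p1 : 1 - z != 0 by rewrite gt_eqF //; lra.
have p2 : 2 * expR z - z * (1 + expR z) != 0 by rewrite gt_eqF //; nra.
(* Expanding the fraction by e^z removes e^(-z) and gives [a 3 1] the denominator of [a 3 2]. *)
have a31 : a 3 1 z = expR z / (2 * expR z - z * (1 + expR z)).
  rewrite /a /TIF2_Heun expRN.
  have p3 : 2 - z * (1 + (expR z)^-1) != 0.
    have -> : 2 - z * (1 + (expR z)^-1) =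
      (2 * expR z - z * (1 + expR z)) / expR z by field; rewrite gt_eqF.
    by rewrite mulf_neq0 // invr_neq0 // gt_eqF.
  by field; rewrite p2 gt_eqF.
rewrite a31 /a /TIF2_Heun /=.
rewrite (_ : (1 / (1 - z))^-1 + z / 2 = 1 - z / 2); last by field.
rewrite (_ : _ / _ + z = expR z); last by field; rewrite ?p1 ?p2.
rewrite (_ : _^-1 + z / 2 = 2 * expR z - z / 2 - z * expR z); last by field.
apply: quad_form_ge0; first lra.
(* With c the last coefficient, e^(2z) <= 2 e^z <= c, while 4 (1 - z/2) >= 1. *)
have h : expR z ^+ 2 <= 2 * expR z by nra.
have h' : 2 * expR z <= 2 * expR z - z / 2 - z * expR z by nra.
nra.
Qed.

(** The tangent bound 1 - z <= e^(-z) times e^z; it makes the numerator of the NIF2 coefficient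
    [a 3 2] positive for z < 0. *)
Lemma expR_tangent (z : R) : expR z * (1 - z) <= 1.
Proof.
by rewrite mulrC -ler_pdivlMr ?expR_gt0 // div1r -expRN expR_ge1Dx.
Qed.

Lemma NIF2_Heun32E (z : R) : z < 0 ->
  NIF2_Heun 3 2 z = (2 - 2 * expR z + z * expR z) / (- (2 * z)).
Proof. by move=> z0 /=; field; rewrite lt_eqF. Qed.

Lemma NIF2_Heun_neq0 (z : R) : z < 0 ->
  NIF2_Heun 2 1 z != 0 /\ NIF2_Heun 3 2 z != 0.
Proof.
move=> z0; have e1 : expR z < 1 by rewrite expR_lt1.
have tan := expR_tangent z.
rewrite NIF2_Heun32E //=; split.
  by rewrite mulf_neq0 ?invr_neq0 // lt_eqF //; lra.
by rewrite mulf_neq0 ?invr_neq0 // gt_eqF //; lra.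
Qed.

(* With w = -z and q = e^z, D = [[w (1 + q) / (2 (1 - q)), 0],
   [w q / (1 - q), w (2 + 2 q + w q) / (2 (2 - 2 q - w q))]]. *)
Lemma NIF2_Heun_ge0 (z x y : R) (a := NIF2_Heun) : z < 0 ->
  0 <= ((a 2 1 z)^-1 + z / 2) * x ^+ 2 +
    ((a 2 1 z - a 3 1 z) / (a 2 1 z * a 3 2 z) + z) * (x * y) +
    ((a 3 2 z)^-1 + z / 2) * y ^+ 2.
Proof.
move=> z0; have [p21 p32] := NIF2_Heun_neq0 z0.
have q0 := expR_gt0 z; have q1 : expR z < 1 by rewrite expR_lt1.
have tan := expR_tangent z.
(* The last-stage weights sum to [a 2 1], which collapses the off-diagonal entry to
   [(a 2 1 z)^-1 + z]. *)
have a21 : a 2 1 z - a 3 1 z = a 3 2 z by [].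
rewrite a21 (_ : a 3 2 z / _ = (a 2 1 z)^-1); last first.
  by rewrite /a; field; rewrite p21.
rewrite /a NIF2_Heun32E //=.
move: (expR z) q0 q1 tan => q q0 q1 tan {p21 p32 a21 a}.
set t := 2 - 2 * q + z * q.
have t0 : 1 - q <= t by rewrite /t; lra.
have tn : t != 0 by rewrite gt_eqF //; lra.
have zn : z != 0 by rewrite lt_eqF.
have qn : q - 1 != 0 by rewrite lt_eqF //; lra.
rewrite (_ : ((q - 1) / z)^-1 + z / 2 = z * (1 + q) / (2 * (q - 1))); last first.
  by field; rewrite zn qn.
rewrite (_ : ((q - 1) / z)^-1 + z = z * q / (q - 1)); last by field; rewrite zn qn.
rewrite (_ : (t / - (2 * z))^-1 + z / 2 = z * (t - 4) / (2 * t)); last first.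
  by field; rewrite zn tn.
apply: quad_form_ge0.
  by rewrite -mulrNN -invrN divr_gt0 //; nra.
(* It remains to see that q^2 t <= (1 - q^2) (4 - t). The value 2 (1 - q) separates the two sides,
   because 0 < t <= 2 - 2 q < 2. *)
rewrite -subr_ge0 (_ : _ - _ = z ^+ 2 * ((1 - q ^+ 2) * (4 - t) - q ^+ 2 * t) /
    ((q - 1) ^+ 2 * t)); last by field; rewrite tn qn.
have t2 : t <= 2 - 2 * q by rewrite /t; nra.
have h1 : q ^+ 2 * t <= 1 * (2 - 2 * q) by rewrite ler_pM //; nra.
have h2 : (1 - q) * 2 <= (1 - q ^+ 2) * (4 - t) by rewrite ler_pM //; nra.
apply: divr_ge0; apply: mulr_ge0; rewrite ?sqr_ge0 //; lra.
Qed.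

End HeunCoefficients.

Theorem theorem3p1 (R : realType) (M : nat) (Lh : 'M[R]_M) (G g : R -> R)
    (lg kappa tau : R)
    (hL : sym_posdef Lh)
    (hG0 : forall x : R, 0 <= G x)
    (hGd : forall x : R, derivable G x 1)
    (hg : forall x : R, g x = - (G^`())%classic x)
    (hlg : 0 < lg)
    (hlip : lg.-lipschitz g)
    (hkappa : 2 * lg <= kappa)
    (htau : 0 < tau) :
  preserves_energy_law 2 TIF2_Heun Lh G g kappa tau /\
  preserves_energy_law 2 NIF2_Heun Lh G g kappa tau.
Proof.
have Gub := lipschitz_gradient hGd hg (ltW hlg) hlip.
split; apply: (two_stage_energy_law hL htau (ltW hlg) hkappa Gub).
- exact: TIF2_Heun_neq0.
- exact: TIF2_Heun_ge0.
- exact: NIF2_Heun_neq0.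
- exact: NIF2_Heun_ge0.
Qed.
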